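(* Let $(X,\mathcal B,\mu)$ be the probability space and $f:X\to X$ the odometer described in the context, and let $1\le p<\infty$. Then the composition operator $T_f:\varphi\mapsto\varphi\circ f$ on $L^p(X,\mathcal B,\mu)$ is not topologically mixing.
   Context: Let $X=\prod_{i=1}^\infty A_i$, where $A_i=\{0,1\}$ if $i$ is even and $A_i=\{0,1,\ldots,2i-1\}$ if $i$ is odd. Each $A_i$ carries the discrete topology and the probability measure $\mu_i$ on $2^{A_i}$ given on atoms by: $\mu_i(0)=\mu_i(1)=\frac12$ if $i$ is even; and, if $i$ is odd, $\mu_i(j)=\frac{1-2^{-i}}{i}$ for $j\in\{0,\ldots,i-1\}$ and $\mu_i(j)=\frac{2^{-i}}{i}$ for $j\in\{i,\ldots,2i-1\}$. Let $\mathcal B$ be the product $\sigma$-algebra and $\mu$ the product measure of the $\mu_i$ on $X$. The odometer $f:X\to X$ is defined as follows. If $x^*=(\max A_i)_{i=1}^\infty$ then $f(x^* )=(0,0,0,\ldots)$. If $x=(x_i)\ne x^*$, let $\ell(x)=\min\{i\ge1: x_i<\max A_i\}$ and let $f(x)$ be the sequence with $f(x)_i=0$ for $i<\ell(x)$, $f(x)_i=x_i+1$ for $i=\ell(x)$, and $f(x)_i=x_i$ for $i>\ell(x)$. The map $f$ is a homeomorphism of $X$, and $T_f$ is a bounded linear operator on $L^p(X,\mathcal B,\mu)$. A bounded linear operator $T$ on a Banach space $\mathcal X$ is topologically mixing if for any nonempty open sets $U,V\subset\mathcal X$ there exists an integer $k_0\ge0$ such that $T^k(U)\cap V\ne\emptyset$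 for every $k\ge k_0$. *)

(* Defs.v *)
From HB Require Import structures.
From mathcomp Require Import all_boot all_order all_algebra.
From mathcomp Require Import all_classical all_reals all_analysis.
From mathcomp Require Import measurable_realfun.

Set Implicit Arguments.
Unset Strict Implicit.
Unset Printing Implicit Defensive.

Import Order.TTheory GRing.Theory Num.Theory.
Import numFieldNormedType.Exports.

Local Open Scope classical_set_scope.
Local Open Scope ring_scope.

Definition topologically_mixing (E : topologicalType) (T : E -> E) : Prop :=
  forall U V : set E, open U -> U !=set0 -> open V -> V !=set0 ->
  exists k0 : nat, forall k : nat, (k0 <= k)%N ->
    (iter k T @` U) `&` V !=set0.

(* The distance || phi - psi ||_p on the library's space L^p of classes of
   measurable functions modulo almost everywhere equality. *)
Section Lspace_metric.
Context d (T : measurableType d) (R : realType).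
Variables (mu : {measure set T -> \bar R}) (p : \bar R) (p1 : (1 <= p)%E).

HB.instance Definition _ := gen_eqMixin (LspaceType mu p1).
HB.instance Definition _ := gen_choiceMixin (LspaceType mu p1).

Definition Ldist (f g : LspaceType mu p1) : R :=
  fine ('N[mu]_p[EFin \o ((f : T -> R) \- (g : T -> R))%R])%E.

Let mLspace (f : LspaceType mu p1) : measurable_fun setT (f : T -> R).
Proof. exact: (@measurable_funPT _ _ _ _ (repr (LebesgueSpace.sort f))). Qed.

Let Lspace_lty (f : LspaceType mu p1) :
  ('N[mu]_p[EFin \o (f : T -> R)] < +oo)%E.
Proof. exact: (@Lebesgue_finite _ _ _ _ _ p1 f). Qed.

Let Ldist_lty (f g : LspaceType mu p1) :
  ('N[mu]_p[EFin \o ((f : T -> R) \- (g : T -> R))%R] < +oo)%E.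
Proof.
have mN : measurable_fun setT (\- (g : T -> R)).
  exact: measurableT_comp (mLspace g).
apply: le_lt_trans (eminkowski mu (mLspace f) mN p1) _.
rewrite lte_add_pinfty ?Lspace_lty//.
have -> : EFin \o (\- (g : T -> R))%R = (\- (EFin \o (g : T -> R)))%E by [].
by rewrite oppe_Lnorm; exact: Lspace_lty.
Qed.

Let LdistE (f g : LspaceType mu p1) :
  ((Ldist f g)%:E = 'N[mu]_p[EFin \o ((f : T -> R) \- (g : T -> R))%R])%E.
Proof.
rewrite /Ldist fineK// fin_numElt Ldist_lty andbT.
by rewrite (lt_le_trans ltNy0) ?Lnorm_ge0.
Qed.

Let Ldistxx f : Ldist f f = 0.
Proof.
apply: EFin_inj; rewrite LdistE.
rewrite (_ : EFin \o _ = cst 0%E) ?Lnorm0 ?gt_eqF ?(lt_le_trans _ p1)//.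
by apply/funext => x /=; rewrite subrr.
Qed.

Let Ldist_eq0 f g : Ldist f g = 0 -> f = g.
Proof.
move=> fg0; have {}fg0 := congr1 EFin fg0; rewrite LdistE in fg0.
have /measurable_EFinP mfg : measurable_fun setT ((f : T -> R) \- (g : T -> R)).
  by apply: measurable_funB; exact: mLspace.
have fg : (f : T -> R) = (g : T -> R) %[ae mu].
  apply: filterS (Lnorm_eq0_eq0 mfg (lt_le_trans lte01 p1) fg0) => x /= + _.
  by move=> /(_ I) [] /eqP; rewrite subr_eq0 => /eqP.
have {fg fg0 mfg} : LebesgueSpace.sort f = LebesgueSpace.sort g.
  rewrite -[LHS](@reprK _ (aeEqMfun (measurableTypeR R) mu)).
  rewrite -[RHS](@reprK _ (aeEqMfun (measurableTypeR R) mu)).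
  by apply/eqmodP/asboolP.
case: f g => [f [[fP]]] [g [[gP]]] /= fg.
by subst g; rewrite (Prop_irrelevance fP gP).
Qed.

Let Ldist_sym f g : Ldist f g = Ldist g f.
Proof.
apply: EFin_inj; rewrite !LdistE -oppe_Lnorm; congr Lnorm.
by apply/funext => x; rewrite -[LHS]/(- (_ - _))%:E opprB.
Qed.

Let Ldist_triangle g f h : Ldist f h <= Ldist f g + Ldist g h.
Proof.
rewrite -lee_fin EFinD !LdistE.
have mB (f1 f2 : LspaceType mu p1) :
    measurable_fun setT ((f1 : T -> R) \- (f2 : T -> R)).
  by apply: measurable_funB; exact: mLspace.
apply: le_trans (eminkowski mu (mB f g) (mB g h) p1).
rewrite le_eqVlt; apply/orP; left; apply/eqP; congr Lnorm.
by apply/funext => x /=; rewrite subrKA.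
Qed.

HB.instance Definition _ := @isMetric.Build R (LspaceType mu p1)
  Ldist Ldistxx Ldist_eq0 Ldist_sym Ldist_triangle.

End Lspace_metric.

(* T is the operator T_f on L^p(mu): the class of phi is sent to the class of
   phi \o f, for every representative phi. *)
Definition is_composition_operator d (E : measurableType d) (R : realType)
    (mu : {measure set E -> \bar R}) (p : \bar R) (p1 : (1 <= p)%E)
    (f : E -> E) (T : LspaceType mu p1 -> LspaceType mu p1) : Prop :=
  forall (u : LspaceType mu p1) (phi : {mfun E >-> R}),
    (u : E -> R) = phi %[ae mu] -> (T u : E -> R) = phi \o f %[ae mu].

(* The alphabet A_i, i >= 1, is {0, ..., maxA i}: it has 2i elements for odd i
   and 2 elements for even i. *)
Definition maxA (i : nat) : nat := if odd i then (i.*2).-1 else 1%N.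

Notation digit i := 'I_(maxA i).+1.

(* Coordinates are numbered from 0, alphabets from 1: x n is the digit x_(n+1),
   in A_(n+1). *)
Definition digits : Type := forall n : nat, digit n.+1.

HB.instance Definition _ := gen_eqMixin digits.
HB.instance Definition _ := gen_choiceMixin digits.
HB.instance Definition _ := isPointed.Build digits (fun=> ord0).

Definition cylinders : set (set digits) :=
  [set C | exists n (B : {set digit n.+1}), C = [set x | x n \in B]].

(* X carries the product sigma-algebra, generated by the coordinate maps. *)
Definition X : measurableType cylinders.-sigma := g_sigma_algebraType cylinders.

Definition odometer (x : X) : X :=
  match pselect (exists n, x n != ord_max) with
  | left H =>
      let l := ex_minn H in
      fun n => if (n < l)%N then ord0
               else if n == l then inord (x n).+1
               else x n
  | right _ => fun=> ord0
  end.

Section product_measure.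
Variable R : realType.

Definition mu_atom (i : nat) (j : digit i) : R :=
  if odd i then
    if (j < i)%N then (1 - 2 ^- i) / i%:R else 2 ^- i / i%:R
  else 2^-1.

Definition mu_ (i : nat) (B : {set digit i}) : R := \sum_(j in B) mu_atom j.

(* The values on the finite-dimensional rectangles, which form a pi-system
   generating the sigma-algebra, determine mu. *)
Definition is_product_measure (mu : probability X R) : Prop :=
  forall (n : nat) (B : forall k : nat, {set digit k.+1}),
    mu [set x : X | forall k : nat, (k < n)%N -> x k \in B k] =
    (\prod_(k < n) mu_ (B k))%:E.

End product_measure.

(* Main.v *)
Require Import Defs.
From HB Require Import structures.
From mathcomp Require Import all_boot all_order all_algebra.
From mathcomp Require Import all_classical all_reals all_analysis.
From mathcomp Require Import measurable_realfun.
From mathcomp Require Import zify lra.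

(** Let k = |A_1| ... |A_m| with m even and positive.  Then f^k is the odometer
    acting on the digits after the m-th one.  If the digit of index m+1 is less
    than m, f^k only adds 1 to it, and both the old and the new value lie in
    {0, ..., m}, where the weights are equal; hence f^k preserves the measure on
    the set S of such points, and mu(S) > 1/2.  Suppose that phi is close to 0
    and T_f^k phi = phi \o f^k is close to 1 in L^p.  By Markov's inequality,
    |phi| >= 1/2 has measure at most 1/4, hence so has the part of S where
    |phi \o f^k| >= 1/2, while |phi \o f^k| < 1/2 also has measure at most 1/4,
    so mu(S) <= 1/2.  Such k being arbitrarily large, T_f is not mixing. *)

Set Implicit Arguments.
Unset Strict Implicit.

Import Order.TTheory GRing.Theory Num.Theory.

Local Open Scope classical_set_scope.
Local Open Scope ring_scope.

(** * Carries and iterates of the odometer *)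

Lemma eqn_mod_dvdS a d : (a %% d.+1 == d)%N = (d.+1 %| a.+1)%N.
Proof.
rewrite /dvdn -[in RHS]addn1 -modnDml addn1.
move: (a %% _)%N (ltn_pmod a (ltn0Sn d)) => r.
rewrite ltnS leq_eqVlt => /orP[/eqP ->|lt_d].
  by rewrite eqxx modnn.
by rewrite modn_small ?ltnS// ltn_eqF.
Qed.

Definition maxed (m n : nat) (x : X) : bool :=
  all (fun i => x i == ord_max) (index_iota m n).

(* The odometer acting on the digits numbered from m on. *)
Definition tail_odometer (m : nat) (x : X) : X := fun n =>
  if (n < m)%N then x n else if maxed m n x then ordS (x n) else x n.

Lemma maxedP m n (x : X) :
  reflect (forall i, (m <= i < n)%N -> x i = ord_max) (maxed m n x).
Proof.
apply: (iffP allP) => H i.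
  by move=> mn; apply/eqP/H; rewrite mem_index_iota.
by rewrite mem_index_iota => mn; apply/eqP/H.
Qed.

Lemma ordS_max n : ordS (@ord_max n) = ord0.
Proof. by apply/val_inj; rewrite /= modnn. Qed.

(** The cyclic successor [ordS] covers all cases of the definition: it sends maximal digits to 0, is
    an honest +1 at the first non-maximal digit, and that digit blocks the carry to all later ones.
    The all-maximal point falls under the same rule. *)
Lemma odometerE : odometer = tail_odometer 0.
Proof.
apply/funext => x; rewrite /odometer; case: pselect => [H|nH].
  case: ex_minnP => l xl lmin; apply: functional_extensionality_dep => n.
  rewrite /tail_odometer ltn0.
  have lt_max i : (i < l)%N -> x i = ord_max.
    by move=> il; apply/eqP; apply: contraTT il => /lmin; rewrite -leqNgt.
  case: ltngtP => nl.
  - case: maxedP => [_|[]]; first by rewrite lt_max// ordS_max.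
    by move=> i /= ni; apply: lt_max; apply: ltn_trans nl.
  - by case: maxedP => // /(_ l) /= => /(_ nl) xlE; rewrite xlE eqxx in xl.
  - rewrite {n}nl; case: maxedP => [_|[]]; last by move=> i /lt_max.
    have xl_lt : (x l < Defs.maxA l.+1)%N.
      by rewrite ltn_neqAle -[(_ <= _)%N]ltnS ltn_ord andbT.
    by apply/val_inj; rewrite /= inordK ?modn_small.
apply: functional_extensionality_dep => n; rewrite /tail_odometer ltn0.
have xmax i : x i = ord_max.
  by apply/eqP; apply/negP => /negP xi; apply: nH; exists i.
by case: maxedP => [_|[] //]; rewrite xmax ordS_max.
Qed.

Lemma tail_odometer_lt m (x : X) n : (n < m)%N -> tail_odometer m x n = x n.
Proof. by rewrite /tail_odometer => ->. Qed.

Lemma iter_tail_odometer_lt m j (x : X) n :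
  (n < m)%N -> iter j (tail_odometer m) x n = x n.
Proof. by move=> nm; elim: j => //= j <-; rewrite tail_odometer_lt. Qed.

Lemma maxed_ltn m n (x : X) :
  (m < n)%N -> maxed m n x = (x m == ord_max) && maxed m.+1 n x.
Proof.
move=> mn; rewrite /maxed /index_iota.
by rewrite -[(n - m)%N](@prednK) ?subn_gt0//= subnS.
Qed.

Lemma eq_maxed m n (x y : X) :
  (forall i, (m <= i < n)%N -> x i = y i) -> maxed m n x = maxed m n y.
Proof.
by move=> xy; apply/maxedP/maxedP => H i mn; rewrite -(H i mn) xy.
Qed.

Lemma maxednn m (x : X) : maxed m m x.
Proof. by rewrite /maxed /index_iota subnn. Qed.

Lemma tail_odometer_eq m (x : X) : tail_odometer m x m = ordS (x m).
Proof. by rewrite /tail_odometer ltnn maxednn. Qed.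

Lemma tail_odometer_gt m (x : X) n : (m < n)%N ->
  tail_odometer m x n =
  if x m == ord_max then tail_odometer m.+1 x n else x n.
Proof.
move=> mn; rewrite /tail_odometer ltnNge (ltnW mn)/= ltnNge mn/= maxed_ltn//.
by case: eqP.
Qed.

Lemma iter_tail_odometer_digit m j (x : X) :
  iter j (tail_odometer m) x m = ((x m + j) %% (Defs.maxA m.+1).+1)%N :> nat.
Proof.
elim: j => [|j IHj]; first by rewrite addn0 modn_small.
by rewrite iterS tail_odometer_eq /= IHj -addn1 modnDml -addnA addn1.
Qed.

(* The digits after the m-th one only see the carries out of digit m. *)
Lemma iter_tail_odometer_gt m j (x : X) n : (m < n)%N ->
  iter j (tail_odometer m) x n =
  iter ((x m + j) %/ (Defs.maxA m.+1).+1)%N (tail_odometer m.+1) x n.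
Proof.
move=> mn; elim: j n mn => [|j IHj] n mn.
  by rewrite addn0 divn_small.
set s := (Defs.maxA m.+1).+1 in IHj *.
rewrite iterS tail_odometer_gt// -val_eqE /= iter_tail_odometer_digit -/s.
(* Digit [m] is maximal, so that the next step carries, exactly when the quotient by [s] is about to
   increase. *)
have -> : ((x m + j) %% s == Defs.maxA m.+1)%N = (s %| (x m + j).+1)%N.
  exact: eqn_mod_dvdS.
rewrite addnS divnS//; case: ifP => _; last by rewrite IHj.
rewrite add1n iterS /tail_odometer -/(tail_odometer m.+1) ltnS IHj//.
(* The carry into digit [n] depends only on the digits strictly between [m] and [n], to which the
   induction hypothesis also applies. *)
rewrite (@eq_maxed _ _ _ (iter ((x m + j) %/ s)%N (tail_odometer m.+1) x))//.
by move=> i /andP[mi _]; rewrite IHj.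
Qed.

(** A full turn of digit [m] restores it and emits exactly one carry, whatever its initial value. *)
Lemma iter_tail_odometer_cycle m :
  iter (Defs.maxA m.+1).+1 (tail_odometer m) = tail_odometer m.+1.
Proof.
apply/funext => x; apply: functional_extensionality_dep => n.
case: (ltngtP n m) => nm.
- by rewrite iter_tail_odometer_lt// tail_odometer_lt// ltnS ltnW.
- by rewrite iter_tail_odometer_gt// divnDr// divnn divn_small.
- rewrite {n}nm tail_odometer_lt//; apply: ord_inj.
  by rewrite iter_tail_odometer_digit modnDr modn_small.
Qed.

Definition radix (m : nat) : nat := (\prod_(i < m) (Defs.maxA i.+1).+1)%N.

Lemma iter_odometer_radix m : iter (radix m) odometer = tail_odometer m.
Proof.
elim: m => [|m IHm]; first by rewrite /radix big_ord0 odometerE.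
rewrite -iter_tail_odometer_cycle -IHm; apply/funext => x.
by rewrite /radix big_ord_recr/= mulnC iterM.
Qed.

(** Every alphabet has at least two digits. This makes the times [radix m] exceed any given [k0]. *)
Lemma leq_radix m : (m <= radix m)%N.
Proof.
elim: m => // m IHm; rewrite /radix big_ord_recr/= -/(radix m).
have : (0 < Defs.maxA m.+1)%N by rewrite /Defs.maxA; case: ifP => //; lia.
have : (0 < radix m)%N by apply: prodn_gt0.
nia.
Qed.

(** * Measurability of the odometer, and boxes as a generating pi-system *)

Lemma measurable_cylinder n (B : {set 'I_(Defs.maxA n.+1).+1}) :
  measurable [set x : X | x n \in B].
Proof. by apply: sub_sigma_algebra; exists n, B. Qed.

Lemma measurable_maxed m n : measurable [set x : X | maxed m n x].
Proof.
rewrite /maxed; elim: (index_iota m n) => [|i s IHs]/=.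
  by rewrite (_ : [set _ | _] = setT)//; exact/seteqP.
rewrite (_ : [set _ | _] = [set x : X | x i \in [set ord_max]%SET] `&`
    [set x : X | all (fun i => x i == ord_max) s]).
  by apply: measurableI => //; exact: measurable_cylinder.
by apply/seteqP; split=> x /=; rewrite inE => /andP.
Qed.

Lemma measurable_odometer : measurable_fun [set: X] odometer.
Proof.
rewrite odometerE.
apply: (@measurability _ _ X X setT _ cylinders) => //.
move=> _ [_ [n [B ->]] <-].
rewrite setTI.
(* Split according to whether the carry reaches digit [n]. *)
rewrite (_ : _ @^-1` _ =
    ([set x : X | maxed 0 n x] `&`
     [set x : X | x n \in [set j | ordS j \in B]%SET]) `|`
    ([set x : X | x n \in B] `\` [set x : X | maxed 0 n x])).
  by apply: measurableU; [apply: measurableI | apply: measurableD];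
    (exact: measurable_cylinder || exact: measurable_maxed).
apply/seteqP; split => x /=; rewrite /tail_odometer ltn0 inE; case: maxed => //.
- by left.
- by right.
- by case=> [[]|[]].
- by case=> [[]|[]].
Qed.

Lemma measurable_iter d (T : measurableType d) (f : T -> T) k :
  measurable_fun setT f -> measurable_fun setT (iter k f).
Proof.
move=> mf; elim: k => [|k IHk]; first exact: measurable_id.
exact: measurableT_comp mf IHk.
Qed.

Definition box (n : nat) (B : forall k, {set 'I_(Defs.maxA k.+1).+1}) : set X :=
  [set x | forall k, (k < n)%N -> x k \in B k].

Definition boxes : set (set X) := [set C | exists n B, C = box n B].

Lemma measurable_box n B : measurable (box n B).
Proof.
rewrite (_ : box n B = \bigcap_(k in `I_n) [set x : X | x k \in B k])//.
by apply: bigcap_measurableType => k _; exact: measurable_cylinder.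
Qed.

Lemma boxT n : box n (fun=> finset.setT) = setT.
Proof. by apply/seteqP; split => // x _ k _; rewrite finset.in_setT. Qed.

Lemma setI_closed_boxes : setI_closed boxes.
Proof.
move=> _ _ [n [B ->]] [m [C ->]].
(* The guards give the shorter box full sides beyond its length. *)
exists (maxn n m), (fun k =>
  [set j | ((k < n)%N ==> (j \in B k)) && ((k < m)%N ==> (j \in C k))]%SET).
apply/seteqP; split => [x [Bx Cx] k _|x BCx].
  by rewrite inE; apply/andP; split; apply/implyP; [exact: Bx|exact: Cx].
split=> k kn; have := BCx k; rewrite leq_max kn ?orbT => /(_ isT).
  by rewrite inE => /andP[].
by rewrite inE => /andP[].
Qed.

Lemma boxesE : @measurable _ X = <<s boxes >>.
Proof.
apply/seteqP; split.
  apply: smallest_sub; first exact: smallest_sigma_algebra.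
  move=> _ [n [B ->]]; apply: sub_sigma_algebra.
  (* The type of a digit depends on its index, so [inord] transports [j] to the alphabet of index
     [n]; when [k] is [n] it is the identity. *)
  exists n.+1, (fun k =>
    [set j : 'I_(Defs.maxA k.+1).+1 | (k == n) ==> (inord j \in B)]%SET).
  apply/seteqP; split => [x /= Bx k _|x /= /(_ n (ltnSn n))].
    by rewrite inE; apply/implyP => /eqP kn; subst k; rewrite inord_val.
  by rewrite inE eqxx inord_val.
apply: smallest_sub; first exact: sigma_algebra_measurable.
by move=> _ [n [B ->]]; exact: measurable_box.
Qed.

Lemma measurable_tail_odometer m : measurable_fun [set: X] (tail_odometer m).
Proof.
rewrite -iter_odometer_radix; apply: measurable_iter.
exact: measurable_odometer.
Qed.

(** * Preservation of the measure on the steady points *)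

Lemma box_widen n N B : (n <= N)%N ->
  box n B = box N (fun k => if (k < n)%N then B k else finset.setT).
Proof.
move=> nN; apply/seteqP; split => [x Bx k _|x Bx k kn].
  by case: ifPn => [/Bx//|_]; rewrite finset.in_setT.
by have := Bx k (leq_trans kn nN); rewrite kn.
Qed.

(** For even [m], coordinate [m] has the odd alphabet index m+1, hence 2m+2 digits, of which 0, ...,
    m are the heavy ones. The bound excludes m, the one heavy digit whose successor is light. *)
Definition steady (m : nat) : set X := [set x | (x m < m)%N].

Definition steady_image (m : nat) : set X := [set x | (0 < x m <= m)%N].

Lemma measurable_steady m : measurable (steady m).
Proof.
rewrite (_ : steady m = [set x : X |
    x m \in [set j : 'I_(Defs.maxA m.+1).+1 | (j < m)%N]%SET]).
  exact: measurable_cylinder.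
by apply/seteqP; split => x; rewrite /steady /= inE.
Qed.

Lemma measurable_steady_image m : measurable (steady_image m).
Proof.
rewrite (_ : steady_image m = [set x : X |
    x m \in [set j : 'I_(Defs.maxA m.+1).+1 | (0 < j <= m)%N]%SET]).
  exact: measurable_cylinder.
by apply/seteqP; split => x; rewrite /steady_image /= inE.
Qed.

Lemma maxA_even m : ~~ odd m -> Defs.maxA m.+1 = m.*2.+1.
Proof. by move=> m_even; rewrite /Defs.maxA /= m_even. Qed.

(** The only digit that wraps is 2m+1; it goes to 0, which the left side excludes, and it is not
    below [m]. *)
Lemma ordS_steady m (j : 'I_(Defs.maxA m.+1).+1) : ~~ odd m ->
  (0 < ordS j <= m)%N = (j < m)%N.
Proof.
move=> m_even /=; move: (nat_of_ord j) (ltn_ord j) => i.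
rewrite maxA_even// => i_lt; have [i_lt'|i_ge] := ltnP i.+1 m.*2.+2.
  by rewrite modn_small.
have -> : i = m.*2.+1 by lia.
by rewrite modnn; apply/esym/negbTE; lia.
Qed.

Lemma steady_tail_odometer m (x : X) n : ~~ odd m -> steady m x ->
  tail_odometer m x n = if n == m then ordS (x n) else x n.
Proof.
move=> m_even xm; case: ltngtP => nm.
- by rewrite tail_odometer_lt.
- rewrite tail_odometer_gt//; case: eqP => // xmax.
  by move: xm; rewrite /steady /= xmax /= maxA_even//; lia.
- by rewrite nm tail_odometer_eq.
Qed.

Section product_measure.
Context (R : realType) (mu : probability X R).
Hypothesis mu_prod : is_product_measure mu.

Lemma mu_box n B : mu (box n B) = (\prod_(k < n) mu_ R (B k))%:E.
Proof. exact: mu_prod. Qed.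

Lemma mu_box_recr n B :
  (forall k, (k < n)%N -> B k = finset.setT) ->
  mu (box n.+1 B) = (mu_ R (B n))%:E.
Proof.
move=> BT; rewrite mu_box big_ord_recr/=.
(* The total mass of [mu] shows that the factors of the full sides multiply to 1, with no sum of
   atoms to compute. *)
have : mu (box n (fun=> finset.setT)) = 1%E by rewrite boxT probability_setT.
rewrite mu_box => -[prod1].
by under eq_bigr => k _ do rewrite BT//; rewrite prod1 mul1r.
Qed.

(** Reindex the right-hand sum along the bijection [ordS]: in the range concerned, [j] and [ordS j]
    are both heavy, so their atoms agree. *)
Lemma mu_ordS_steady m (B : {set 'I_(Defs.maxA m.+1).+1}) : ~~ odd m ->
  mu_ R [set j : 'I_(Defs.maxA m.+1).+1 | (j < m)%N && (ordS j \in B)]%SET =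
  mu_ R [set j : 'I_(Defs.maxA m.+1).+1 in B | (0 < j <= m)%N]%SET.
Proof.
move=> m_even; rewrite /mu_ [RHS](reindex_inj (@ordS_inj _)).
apply: eq_big => j; rewrite !inE; first by rewrite ordS_steady// andbC.
move=> /andP[jm _].
have jSm : (ordS j < m.+1)%N.
  by rewrite ltnS; have := ordS_steady j m_even; rewrite jm => /andP[].
by rewrite /mu_atom jSm ltnS (ltnW jm).
Qed.

Lemma tail_odometer_steady_box m n
    (B : forall k, {set 'I_(Defs.maxA k.+1).+1}) :
  ~~ odd m -> (m < n)%N ->
  mu (tail_odometer m @^-1` box n B `&` steady m) =
  mu (box n B `&` steady_image m).
Proof.
move=> m_even mn.
(* Both intersections are boxes again: the condition on digit [m] is absorbed into side [m], and the
   two products differ at most in that factor. *)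
pose C k := [set j : 'I_(Defs.maxA k.+1).+1 |
  if k == m then (j < m)%N && (ordS j \in B k) else j \in B k]%SET.
pose D k := [set j : 'I_(Defs.maxA k.+1).+1 in B k |
  (k == m) ==> (0 < j <= m)%N]%SET.
rewrite (_ : _ `&` steady m = box n C); last first.
  apply/seteqP; split => [x [Bx xm] k kn|x Cx].
    have := Bx k kn; rewrite steady_tail_odometer// inE.
    by case: eqP => // km; subst k => ->; rewrite andbT; exact: xm.
  have xm : steady m x by have := Cx m mn; rewrite inE eqxx => /andP[].
  split => // k kn; rewrite steady_tail_odometer//.
  by have := Cx k kn; rewrite inE; case: eqP => // _ /andP[].
rewrite (_ : _ `&` steady_image m = box n D); last first.
  apply/seteqP; split => [x [Bx xm] k kn|x Dx].
    by rewrite inE Bx//=; apply/implyP => /eqP ->.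
  split => [k kn|]; first by have := Dx k kn; rewrite inE => /andP[].
  by have := Dx m mn; rewrite inE eqxx => /andP[].
rewrite !mu_box; congr (_%:E); apply: eq_bigr => k _.
have [km|km] := eqVneq (k : nat) m.
  rewrite /C /D km eqxx; exact: mu_ordS_steady.
by congr mu_; apply/setP => j; rewrite !inE (negbTE km)/= andbT.
Qed.

(** Both sides are finite measures in [A], a pushforward of a restriction and a restriction of [mu].
    They agree on boxes, hence everywhere by uniqueness on a generating pi-system. *)
Lemma tail_odometer_steady m (A : set X) : ~~ odd m -> measurable A ->
  mu (tail_odometer m @^-1` A `&` steady m) = mu (A `&` steady_image m).
Proof.
move=> m_even mA.
pose mS := measurable_steady m; pose mS' := measurable_steady_image m.
have setT_box : boxes setT by exists 0%N, (fun=> finset.setT); rewrite boxT.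
rewrite -[RHS]/(mrestr mu mS' A).
rewrite -[LHS]/(pushforward (mrestr mu mS) (tail_odometer m) A).
apply: (measure_unique boxes (fun=> setT)) => //.
- exact: boxesE.
- exact: setI_closed_boxes.
- exact: bigcup_const.
- exact: measurable_tail_odometer.
- move=> mh _ [n [B ->]].
  have nN : (n <= maxn n m.+1)%N by exact: leq_maxl.
  (* The box must be long enough to have a side [m]. *)
  rewrite (box_widen _ nN).
  by apply: tail_odometer_steady_box; rewrite // leq_maxr.
- move=> mh _; rewrite -[ltLHS]/(mu (tail_odometer m @^-1` setT `&` steady m)).
  by rewrite preimage_setT setTI (le_lt_trans (probability_le1 mu mS))// ltry.
Qed.

(** The measure is m(1 - 2^-(m+1))/(m+1). As [m] is at least 2, the power is at most 1/8, and 7m/8 >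
    (m+1)/2. *)
Lemma mu_steady m : ~~ odd m -> (0 < m)%N -> ((1/2)%:E < mu (steady m))%E.
Proof.
move=> m_even m_gt0.
pose B k : {set 'I_(Defs.maxA k.+1).+1} :=
  [set j : 'I_(Defs.maxA k.+1).+1 | (k == m) ==> (j < m)%N]%SET.
rewrite (_ : steady m = box m.+1 B); last first.
  apply/seteqP; split => [x xm k _|x /(_ m (ltnSn m))]; rewrite inE ?eqxx//.
  by apply/implyP => /eqP ->.
rewrite mu_box_recr => [|k km]; last first.
  by apply/setP => j; rewrite !inE ltn_eqF.
rewrite lte_fin /mu_ /B eqxx.
under eq_bigr => j jm.
  rewrite /mu_atom /= m_even ltnS ltnW; last by move: jm; rewrite inE.
  over.
under eq_bigl do rewrite inE.
rewrite -(big_ord_widen _ (fun=> (1 - 2 ^- m.+1) / m.+1%:R : R)); last first.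
  by rewrite maxA_even//; lia.
rewrite sumr_const card_ord -[ltRHS]mulr_natl mulrA ltr_pdivlMr ?ltr0n//.
have m_ge2 : (2 <= m)%N by case: m m_even m_gt0 {B} => [|[]].
have M_ge2 : 2 <= m%:R :> R by rewrite ler_nat.
have a_le : 2 ^- m.+1 <= 8^-1 :> R.
  rewrite lef_pV2 ?posrE ?exprn_gt0//.
  rewrite [leLHS](_ : _ = 2 ^+ 3); last by rewrite -natrX.
  by rewrite ler_weXn2l// ler1n.
have Ma_le : m%:R * 2 ^- m.+1 <= m%:R * 8^-1 :> R by rewrite ler_wpM2l.
rewrite -(natr1 m) mulrBr mulr1.
by move: (m%:R * 2 ^- _) Ma_le => b; move: m%:R M_ge2 => M; lra.
Qed.

End product_measure.

(** * Norm estimates and representatives in L^p *)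

Section Lspace.
Context d (T : measurableType d) (R : realType).
Implicit Types (mu : {measure set T -> \bar R}) (p : R).

(** Markov's inequality gives the bound (e/a)^p, which is at most e/a because e <= a and p >= 1. The
    weaker bound is free of [p], so the same constants serve for every exponent. *)
Lemma Lnorm_markov mu p a e (f : T -> R) :
  1 <= p -> 0 < e <= a -> measurable_fun setT f ->
  ('N[mu]_p%:E[EFin \o f] <= e%:E)%E ->
  (mu [set x | a <= `|f x|]%R <= (e / a)%:E)%E.
Proof.
move=> p_ge1 /andP[e_gt0 e_le_a] mf fe.
have a_gt0 : 0 < a by exact: lt_le_trans e_le_a.
have p_gt0 : 0 < p by exact: lt_le_trans p_ge1.
have : ((a `^ p)%:E * mu [set x | a <= `|f x|]%R <= (e `^ p)%:E)%E.
  have := @le_integral_comp_abse _ _ _ mu setT measurableT (EFin \o f) a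
    (poweR^~ p) (measurable_poweR p) (fun r _ => poweR_ge0 r p).
  rewrite -poweR_Lnorm ?gt_eqF// setTI poweR_EFin.
  move=> markov; apply: le_trans (markov _ _ a_gt0) _.
  - move=> x y; rewrite !inE/= !in_itv/= !andbT => x_ge0 y_ge0.
    by apply: gt0_ler_poweR; rewrite ?in_itv/= ?x_ge0 ?y_ge0 ?leey// ltW.
  - exact/measurable_EFinP.
  - rewrite -poweR_EFin; apply: gt0_ler_poweR => //; first exact: ltW.
      by rewrite in_itv/= Lnorm_ge0 leey.
    by rewrite in_itv/= leey lee_fin ltW.
rewrite -lee_pdivlMl ?powR_gt0//; move/le_trans; apply.
have ea_ge0 : 0 <= e / a by rewrite divr_ge0// ltW.
have -> : e `^ p = (e / a) `^ p * a `^ p.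
  by rewrite -powRM ?divfK ?gt_eqF// ltW.
rewrite -EFinM lee_fin mulrC mulfK ?gt_eqF ?powR_gt0//.
rewrite -[leRHS]powRr1//; apply: ger_powR => //.
by rewrite divr_gt0//= ler_pdivrMr// mul1r.
Qed.

Lemma ae_eq_Lnorm mu p (f g : T -> R) :
  measurable_fun setT f -> measurable_fun setT g -> f = g %[ae mu] ->
  ('N[mu]_p%:E[EFin \o f] = 'N[mu]_p%:E[EFin \o g])%E.
Proof.
move=> mf mg fg; rewrite unlock; congr poweR.
have mpow (h : T -> R) : measurable_fun setT h ->
    measurable_fun setT (fun x => `|(EFin \o h) x| `^ p)%E.
  move=> mh; apply: (measurableT_comp (measurable_poweR p)).
  by apply: measurableT_comp => //; exact/measurable_EFinP.
apply: ge0_ae_eq_integral => //; [exact: mpow|exact: mpow| | |].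
- by move=> x _; exact: poweR_ge0.
- by move=> x _; exact: poweR_ge0.
- by apply: filterS fg => x /= fg Dx; rewrite fg.
Qed.

Lemma Lspace_measurable mu (p : \bar R) (p1 : (1 <= p)%E)
  (u : LspaceType mu p1) : measurable_fun setT (u : T -> R).
Proof. exact: (@measurable_funPT _ _ _ _ (repr (LebesgueSpace.sort u))). Qed.

Lemma Lspace_Lnorm_lty mu (p : \bar R) (p1 : (1 <= p)%E)
  (u : LspaceType mu p1) : ('N[mu]_p[EFin \o (u : T -> R)] < +oo)%E.
Proof. exact: (@Lebesgue_finite _ _ _ _ _ p1 u). Qed.

Lemma exists_Lspace mu p (p1 : (1 <= p%:E)%E) (f : T -> R) :
  f \in Lfun mu p%:E ->
  exists u : LspaceType mu p1, (u : T -> R) = f %[ae mu].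
Proof.
move=> /andP[fM /[!inE] f_fin]; have /[!inE]/= mf := fM.
have mf' : @measurable_fun _ _ T (measurableTypeR R) setT f by exact: mf.
pose g : aeEqMfun (measurableTypeR R) mu :=
  (\pi_(aeEqMfun (measurableTypeR R) mu)
    (@mfun_Sub _ _ T (measurableTypeR R) f (mem_set mf')))%qT.
have gf : (g : T -> R) = f %[ae mu] by have /eqmodP/asboolP := reprK g.
have g_fin : finite_norm mu p%:E (g : T -> R).
  rewrite /finite_norm (ae_eq_Lnorm _ _ _ gf)//.
  exact: (@measurable_funPT _ _ _ _ (repr g)).
pose u : LspaceType mu p1 :=
  HB.pack g (isFinLebesgue.Build _ _ _ _ _ p1 g g_fin).
by exists u.
Qed.

Lemma Lnorm_le_Ldist mu p (p1 : (1 <= p%:E)%E) (u v : LspaceType mu p1)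
    (f g : T -> R) (e : R) :
  measurable_fun setT f -> measurable_fun setT g ->
  (u : T -> R) = f %[ae mu] -> (v : T -> R) = g %[ae mu] ->
  Ldist u v < e -> ('N[mu]_p%:E[EFin \o (f \- g)%R] <= e%:E)%E.
Proof.
move=> mf mg uf vg.
have mu' := @Lspace_measurable _ _ p1 u; have mv := @Lspace_measurable _ _ p1 v.
rewrite -(@ae_eq_Lnorm mu p (u \- v)%R (f \- g)%R).
(* [Ldist] is a [fine], which sends +oo to 0; the bound transfers to the norm only once Minkowski's
   inequality shows it finite. *)
- move=> uv; rewrite -[leLHS]fineK ?lee_fin ?ltW//.
  rewrite fin_numElt (lt_le_trans ltNy0) ?Lnorm_ge0//=.
  have mNv : measurable_fun setT (\- (v : T -> R)) by exact: measurableT_comp.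
  apply: le_lt_trans (eminkowski mu mu' mNv p1) _.
  rewrite lte_add_pinfty ?Lspace_Lnorm_lty//.
  have -> : EFin \o (\- (v : T -> R))%R = (\- (EFin \o (v : T -> R)))%E by [].
  by rewrite oppe_Lnorm Lspace_Lnorm_lty.
- exact: measurable_funB.
- exact: measurable_funB.
- by apply: filterS2 uf vg => x /= + + Dx => /(_ Dx) -> /(_ Dx) ->.
Qed.

Lemma iter_composition_operator mu (p : \bar R)
    (p1 : (1 <= p)%E) (f : T -> T) (Tf : LspaceType mu p1 -> LspaceType mu p1)
    (u : LspaceType mu p1) k :
  measurable_fun setT f -> is_composition_operator f Tf ->
  (iter k Tf u : T -> R) = (u : T -> R) \o iter k f %[ae mu].
Proof.
move=> mf TfE; elim: k => [|k IHk].
  by apply: nearW => x _.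
have mphi : measurable_fun setT ((u : T -> R) \o iter k f).
  exact: measurableT_comp (@Lspace_measurable _ _ _ u) (measurable_iter k mf).
(* [TfE] accepts any representative, so the induction hypothesis lets [u \o iter k f] stand for
   [iter k Tf u]. *)
have := TfE (iter k Tf u) (mfun_Sub (mem_set mphi)) IHk.
apply: filterS => x /= + _ => /(_ I) ->.
by rewrite -[f (iter k f x)]iterS iterSr.
Qed.

End Lspace.

(** * The contradiction with mixing *)

Lemma Lnorm_tail_odometer_far (R : realType) (mu : probability X R)
    (p : R) m (g : X -> R) :
  is_product_measure mu -> 1 <= p -> ~~ odd m -> (0 < m)%N ->
  measurable_fun setT g ->
  ('N[mu]_p%:E[EFin \o g] <= (1/8)%:E)%E ->
  ('N[mu]_p%:E[EFin \o (cst 1%R \- (g \o tail_odometer m))%R] <= (1/8)%:E)%E ->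
  False.
Proof.
move=> mu_prod p_ge1 m_even m_gt0 mg g_le g1_le.
have mh := measurable_tail_odometer m.
have mgh : measurable_fun setT (cst 1 \- (g \o tail_odometer m)).
  by apply: measurable_funB => //; exact: measurableT_comp.
have mge (f : X -> R) : measurable_fun setT f ->
    measurable [set x | 1/2 <= `|f x|].
  move=> mf; rewrite -[X in measurable X]setTI.
  have /measurable_EFinP := measurableT_comp (@normr_measurable R setT) mf.
  by move=> /(emeasurable_fun_c_infty measurableT) /(_ (1/2)%:E).
have := mu_steady mu_prod m_even m_gt0; apply/negP; rewrite -leNgt.
set A := [set x | 1/2 <= `|g x|].
set A' := [set x | 1/2 <= `|(cst 1 \- (g \o tail_odometer m)) x|].
have mA : measurable A by exact: mge.
have mA' : measurable A' by exact: mge.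
have mhA : measurable (tail_odometer m @^-1` A).
  by rewrite -[X in measurable X]setTI; exact: mh.
(* Norm at most 1/8 and threshold 1/2 bound each exceptional set by 1/4; the two together reach at
   most 1/2. *)
have eps : 0 < (1/8 : R) <= 1/2 by apply/andP; split; lra.
have A_le := Lnorm_markov p_ge1 eps mg g_le.
have A'_le := Lnorm_markov p_ge1 eps mgh g1_le.
have mS := measurable_steady m; have mS' := measurable_steady_image m.
have mI : measurable (tail_odometer m @^-1` A `&` steady m).
  exact: measurableI.
have sub : steady m `<=` A' `|` (tail_odometer m @^-1` A `&` steady m).
  move=> x xS; have [xA|xA] := leP (1/2) `|g (tail_odometer m x)|.
    by right.
  left; rewrite /A' /=; move: xA.
  by rewrite ltr_norml => /andP[? ?]; rewrite ger0_norm; lra.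
have I_le : (mu (tail_odometer m @^-1` A `&` steady m) <= (1/8/(1/2))%:E)%E.
  rewrite (tail_odometer_steady mu_prod m_even mA).
  apply: le_trans A_le; apply: le_measure; rewrite ?inE//.
  exact: measurableI.
apply: (le_trans (le_measure mu _ _ sub)); rewrite ?inE//.
  exact: measurableU.
apply: (le_trans (measureU2 _ _ _)) => //.
apply: (le_trans (leeD A'_le I_le)).
by rewrite -EFinD lee_fin; lra.
Qed.

Unset Implicit Arguments.

Theorem claimC (R : realType) (mu : probability X R)
    (mu_prod : is_product_measure mu)
    (p : R) (p1 : (1 <= p%:E)%E)
    (Tf : LspaceType mu p1 -> LspaceType mu p1)
    (TfE : is_composition_operator odometer Tf) :
  ~ topologically_mixing Tf.
Proof.
have [u0 u0E] := exists_Lspace p1 (Lfun_cst mu 0 p).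
have [u1 u1E] := exists_Lspace p1 (Lfun_cst mu 1 p).
have eps : 0 < 1/8 :> R by lra.
(* Mixing is tested on open sets, hence the interiors of the balls. *)
have ball_open (u : LspaceType mu p1) :
    open (ball u (1/8))^° /\ (ball u (1/8))^° !=set0.
  split; first exact: open_interior.
  by exists u; exact: nbhsx_ballx.
move=> /(_ (ball u0 (1/8))^° (ball u1 (1/8))^°
  (ball_open u0).1 (ball_open u0).2 (ball_open u1).1 (ball_open u1).2).
(* This [m] is even, positive and above [k0], so the time [radix m] is one at which mixing
   applies. *)
case=> k0 mixing; pose m := k0.+1.*2.
have k0_le : (k0 <= radix m)%N.
  by apply: leq_trans (leq_radix m); rewrite /m; lia.
have [_ [[u /interior_subset u0u <-] /interior_subset u1u]] := mixing _ k0_le.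
have mu' := Lspace_measurable u; have mh := measurable_tail_odometer m.
have Tu := iter_composition_operator u (radix m) measurable_odometer TfE.
rewrite iter_odometer_radix in Tu.
apply: (@Lnorm_tail_odometer_far R mu p m u) => //.
- by rewrite /m odd_double.
- rewrite (_ : EFin \o _ = EFin \o ((u : X -> R) \- cst 0)%R); last first.
    by apply/funext => x /=; rewrite subr0.
  apply: (Lnorm_le_Ldist _ _ _ u0E) => //.
    by apply: nearW.
  by have := ball_sym u0u; rewrite ballEmdist.
- apply: (Lnorm_le_Ldist _ _ u1E Tu u1u) => //.
  exact: measurableT_comp.
Qed.
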